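(* Let $G$ be a finite nilpotent group. Then $\Gamma^*(G)$ is a star if and only if either $G$ is a group of order $pq$ or $G$ is the cyclic group of order $p^rq$, for some distinct primes $p,q$ and some integer $r\geq 2$.
   Context: For a group $G$, the co-maximal subgroup graph $\Gamma(G)$ is the simple undirected graph whose vertices are the non-trivial proper subgroups of $G$, two distinct vertices $H,K$ being adjacent if and only if $HK=G$, where $HK=\{hk : h\in H, k\in K\}$. The deleted co-maximal subgroup graph $\Gamma^*(G)$ is the graph obtained by removing all isolated vertices from $\Gamma(G)$. A star is a graph isomorphic to the complete bipartite graph $K_{1,m}$ for some integer $m\geq 1$ (so $K_2$ is a star). *)

(* Defs.v *)
From mathcomp Require Import all_boot all_fingroup all_solvable.

Set Implicit Arguments.
Unset Strict Implicit.
Unset Printing Implicit Defensive.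

Record sgraph := SGraph {
  vertex :> finType;
  edge : rel vertex;
  edge_sym : symmetric edge;
  edge_irrefl : irreflexive edge
}.

Definition graph_iso (A B : sgraph) : Prop :=
  exists2 f : A -> B, bijective f & {mono f : x y / edge x y}.

Definition bipartite_edge (m n : nat) : rel ('I_m + 'I_n)%type :=
  fun x y => match x, y with
             | inl _, inr _ | inr _, inl _ => true
             | _, _ => false
             end.

Fact bipartite_edge_sym m n : symmetric (@bipartite_edge m n).
Proof. by case=> [i|i] [j|j]. Qed.

Fact bipartite_edge_irrefl m n : irreflexive (@bipartite_edge m n).
Proof. by case. Qed.

Definition complete_bipartite (m n : nat) : sgraph :=
  SGraph (@bipartite_edge_sym m n) (@bipartite_edge_irrefl m n).

Definition is_star (A : sgraph) : Prop :=
  exists2 m : nat, 0 < m & graph_iso A (complete_bipartite 1 m).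

Definition isolated (A : sgraph) (x : A) : bool := [forall y, ~~ edge x y].

Section DeleteIsolated.

Variable A : sgraph.

Definition deleted_vertex : finType := {x : A | ~~ isolated x}.

Definition deleted_edge : rel deleted_vertex :=
  fun x y => edge (val x) (val y).

Fact deleted_edge_sym : symmetric deleted_edge.
Proof. by move=> x y; rewrite /deleted_edge edge_sym. Qed.

Fact deleted_edge_irrefl : irreflexive deleted_edge.
Proof. by move=> x; rewrite /deleted_edge edge_irrefl. Qed.

Definition delete_isolated : sgraph :=
  SGraph deleted_edge_sym deleted_edge_irrefl.

End DeleteIsolated.

Section Comaximal.

Variables (gT : finGroupType) (G : {group gT}).

Definition comax_vertex : finType :=
  {H : {group gT} | (H :!=: 1%g) && (H \proper G)}.

(* H * K is the set product {hk : h in H, k in K}, not the join of H and K. *)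
Definition comax_edge : rel comax_vertex :=
  fun H K => (H != K) && ((val H * val K)%g == G :> {set gT}).

Fact comax_edge_sym : symmetric comax_edge.
Proof.
move=> H K; rewrite /comax_edge eq_sym; congr (_ && _).
by rewrite -invMG -[X in _ == X]invGid (inj_eq invg_inj).
Qed.

Fact comax_edge_irrefl : irreflexive comax_edge.
Proof. by move=> H; rewrite /comax_edge eqxx. Qed.

Definition comax_graph : sgraph := SGraph comax_edge_sym comax_edge_irrefl.

Definition deleted_comax_graph : sgraph := delete_isolated comax_graph.

End Comaximal.

(* Main.v *)
Require Import Defs.
From mathcomp Require Import all_boot all_fingroup all_solvable.

Set Implicit Arguments.
Unset Strict Implicit.
Unset Printing Implicit Defensive.

(** Deleting the isolated vertices of a graph leaves a star exactly when the
    graph has an edge and all its edges pass through a common vertex, the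
    centre.

    If the co-maximal graph of a nilpotent group [G] has a centre then [G] is
    cyclic. Maximal subgroups of a nilpotent group are normal, so any two
    distinct ones are adjacent; since all edges share the centre there is no
    triangle, hence there are at most two maximal subgroups. The ends of an edge
    lie in two distinct maximal subgroups [M] and [N], and a group is not the
    union of two proper subgroups; an element outside of [M] and [N] lies in no
    maximal subgroup, so it generates [G] ([comax_centre_cyclic]).

    In a cyclic group of order [n], a subgroup is determined by its index, which
    can be any divisor of [n], and [H * K = G] holds exactly when the indices of
    [H] and [K] are coprime ([cyclic_mulG_coprime_index]). The index [k] of a
    centre then belongs to every pair of coprime divisors of [n] greater than 1.
    This makes [k] a prime, and some other prime [p] divides [n]. Write
    [n = p ^ r * m] with [m] prime to [p]; the pair [(p, m)] forces [m = k].
    Conversely, if [n = p ^ r * q] then one of two coprime divisors greater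
    than 1 is prime to [p], so it is [q] ([cyclic_comax_centreP]). A nilpotent
    group of order [p * q] is cyclic, so both families of the theorem are the
    cyclic groups of order [p ^ r * q] with [r > 0]. *)

(** * Stars and centres *)

Section Centre.

Variable A : sgraph.

Definition is_centre (c : A) : Prop :=
  (exists y, edge c y) /\ (forall x y, edge x y -> x = c \/ y = c).

Lemma edge_nonisolated (x y : A) : edge x y -> ~~ isolated x.
Proof. by move=> xy; apply/forallPn; exists y; rewrite negbK. Qed.

Lemma star_centre : is_star (delete_isolated A) -> exists c : A, is_centre c.
Proof.
case=> m m_gt0 [f [g fK gK] f_edge].
exists (val (g (inl ord0))); split.
  exists (val (g (inr (Ordinal m_gt0)))).
  have : edge (g (inl ord0)) (g (inr (Ordinal m_gt0))) by rewrite -f_edge !gK.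
  by [].
move=> x y xy; have yx : edge y x by rewrite edge_sym.
pose x' : delete_isolated A := Sub x (edge_nonisolated xy).
pose y' : delete_isolated A := Sub y (edge_nonisolated yx).
have : edge (f x') (f y') by rewrite f_edge.
case fx: (f x') => [i|i]; case fy: (f y') => [j|j] //= _.
- by left; rewrite -(ord1 i) -fx fK.
- by right; rewrite -(ord1 j) -fy fK.
Qed.

(** Every remaining vertex [x] has a neighbour; that edge passes through the
    centre, so [x] is the centre or is adjacent to it, and no edge joins two
    vertices other than the centre. *)
Lemma centre_star : (exists c : A, is_centre c) -> is_star (delete_isolated A).
Proof.
case=> c [[y0 cy0] centre_c]; have y0c : edge y0 c by rewrite edge_sym.
pose c' : delete_isolated A := Sub c (edge_nonisolated cy0).
pose L := {x : delete_isolated A | x != c'}.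
have c'_edge (x : delete_isolated A) : x != c' -> edge c (val x).
  move=> xc; have /forallPn[y] := valP x; rewrite negbK => xy.
  have [x_c|<-] := centre_c _ _ xy; last by rewrite edge_sym.
  by case/eqP: xc; apply: val_inj.
have y0'_neq : (Sub y0 (edge_nonisolated y0c) : delete_isolated A) != c'.
  by apply/eqP => /(congr1 val) /= eq_y0c; move: (cy0); rewrite eq_y0c edge_irrefl.
exists #|{: L}|; first by apply/card_gt0P; exists (exist (fun x => x != c') _ y0'_neq).
pose f (x : delete_isolated A) : complete_bipartite 1 #|{: L}| :=
  if insub x is Some l then inr (enum_rank (l : L)) else inl ord0.
pose g (z : complete_bipartite 1 #|{: L}|) : delete_isolated A :=
  if z is inr i then val (enum_val i) else c'.
exists f.
  exists g => [x|[i|i]]; rewrite /f /g.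
  - by case: insubP => [l _ <-|/negPn/eqP //]; rewrite enum_rankK.
  - by rewrite insubF ?eqxx ?(ord1 i).
  - by rewrite valK enum_valK.
move=> x y; rewrite /f.
case: insubP => [l xc _|/negPn/eqP->]; case: insubP => [k yc _|/negPn/eqP->].
- apply/esym/negbTE/negP => /centre_c[] eq_c; first by case/eqP: xc; apply: val_inj.
  by case/eqP: yc; apply: val_inj.
- by apply/esym; rewrite edge_sym; apply: c'_edge.
- by apply/esym/c'_edge.
- by rewrite !edge_irrefl.
Qed.

Lemma centre_no_triangle (c x y z : A) :
  is_centre c -> edge x y -> edge y z -> edge x z -> False.
Proof.
have neq (u v : A) : edge u v -> u != v.
  by apply: contraTneq => ->; rewrite edge_irrefl.
case=> _ centre_c xy yz xz; move: (neq _ _ xy) (neq _ _ yz) (neq _ _ xz).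
by case: (centre_c _ _ xy) => e1; case: (centre_c _ _ yz) => e2;
  case: (centre_c _ _ xz) => e3; rewrite ?e1 ?e2 ?e3 ?eqxx.
Qed.

End Centre.

(** * Nilpotent groups *)

(** In a nilpotent group a proper subgroup is smaller than its normaliser. *)
Lemma nilpotent_maximal_normal (gT : finGroupType) (G M : {group gT}) :
  nilpotent G -> maximal M G -> (M <| G)%g.
Proof.
move=> nilG /maxgroupP[prMG maxM]; have sMG := proper_sub prMG.
have prMN := nilpotent_proper_norm nilG prMG.
rewrite /normal sMG; have [|prNG] := eqVproper (subsetIl G 'N(M)%g).
  by move/setIidPl.
by move: (prMN); rewrite (maxM _ prNG (proper_sub prMN)) properxx.
Qed.

Lemma comax_edge_mul (gT : finGroupType) (G : {group gT}) (u v : comax_graph G) :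
  edge u v -> (val u * val v)%g = G.
Proof. by case/andP=> _ /eqP. Qed.

Lemma comax_vertex_sub (gT : finGroupType) (G : {group gT}) (u : comax_graph G) :
  val u \subset G.
Proof. by case/andP: (valP u) => _ /proper_sub. Qed.

(** Three distinct maximal subgroups would form a triangle, so there are at most
    two, and they do not cover [G]. *)
Lemma comax_centre_cyclic (gT : finGroupType) (G : {group gT})
    (c : comax_graph G) : nilpotent G -> is_centre c -> cyclic G.
Proof.
move=> nilG centre_c; have [[d cd] _] := centre_c.
have in_max (u : comax_graph G) :
    exists2 M : {group gT}, maximal M G & val u \subset M.
  have [eqG|//] := maximal_exists (comax_vertex_sub u).
  by case/andP: (valP u) => _; rewrite eqG properxx.
have [M maxM s_cM] := in_max c; have [N maxN s_dN] := in_max d.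
have prMG := maxgroupp maxM; have prNG := maxgroupp maxN.
have neqMN : M != N.
  apply: contraTneq prMG => eqMN; rewrite properE -(comax_edge_mul cd).
  by rewrite mul_subG ?andbF // eqMN.
have max_sub (K L : {group gT}) : maximal K G -> maximal L G ->
    K != L -> ~~ (L \subset K).
  move=> /maxgroupp prKG /maxgroupP[_ maxL]; apply: contra_neqN => sLK.
  by apply/val_inj/maxL.
have neqNM : N != M by rewrite eq_sym.
have [m Mm N'm] := subsetPn (max_sub _ _ maxN maxM neqNM).
have [n Nn M'n] := subsetPn (max_sub _ _ maxM maxN neqMN).
(* The product of an element of M outside of N and one of N outside of M lies in
   neither subgroup. *)
pose x := (m * n)%g.
have M'x : x \notin M by rewrite groupMl.
have N'x : x \notin N by rewrite groupMr.
have Gx : x \in G.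
  by apply: groupM; [apply: (subsetP (proper_sub prMG))
                    | apply: (subsetP (proper_sub prNG))].
have s_xG : (<[x]> \subset G)%g by rewrite cycle_subG.
have [<-|[L maxL s_xL]] := maximal_exists s_xG; first exact: cycle_cyclic.
have Lx : x \in L by rewrite -cycle_subG.
have neqML : M != L by apply: contraNneq M'x => ->.
have neqNL : N != L by apply: contraNneq N'x => ->.
have ntriv (K H : {group gT}) (k : gT) : k \in K -> k \notin H -> K :!=: 1%g.
  by move=> Kk; apply: contraNneq => K1; move: Kk; rewrite K1 => /set1P->.
have vtx (K H : {group gT}) (k : gT) : maximal K G -> k \in K -> k \notin H ->
    (K :!=: 1%g) && (K \proper G).
  by move=> /maxgroupp prKG Kk H'k; rewrite prKG andbT (ntriv K H k).
pose vM : comax_graph G := Sub M (vtx M N m maxM Mm N'm).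
pose vN : comax_graph G := Sub N (vtx N M n maxN Nn M'n).
pose vL : comax_graph G := Sub L (vtx L M x maxL Lx M'x).
have max_edge (u v : comax_graph G) : maximal (val u) G -> maximal (val v) G ->
    val u != val v -> edge u v.
  move=> maxu maxv neq_uv; apply/andP; split=> //; apply/eqP.
  apply: mulg_normal_maximal => //; first exact: nilpotent_maximal_normal.
    exact: comax_vertex_sub.
  exact: max_sub.
by case: (@centre_no_triangle _ c vM vN vL centre_c); apply: max_edge.
Qed.

(** * Cyclic groups *)

Lemma cyclic_exists_index (gT : finGroupType) (G : {group gT}) (d : nat) :
  cyclic G -> d %| #|G| -> exists2 H : {group gT}, H \subset G & #|G : H|%g = d.
Proof.
case/cyclicP=> x ->; rewrite -[#|_|]/#[x]%g => d_x.
have sub : (<[x ^+ d]> \subset <[x]>)%g by rewrite cycleX.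
exists <[x ^+ d]>%G => //; rewrite -divgS //= -!orderE orderXdiv //.
by rewrite divnA // mulKn.
Qed.

Lemma cyclic_sub_index (gT : finGroupType) (G H K : {group gT}) :
  cyclic G -> H \subset G -> K \subset G ->
  (H \subset K) = (#|G : K|%g %| #|G : H|%g).
Proof.
move=> cycG sHG sKG; rewrite -(cardSg_cyclic cycG) //.
by rewrite -(@dvdn_pmul2r #|G : K|%g) // Lagrange // -(Lagrange sHG) dvdn_pmul2l.
Qed.

(** If a prime [p] divides both indices, then [H] and [K] lie in the subgroup of
    index [p], and so does their product. *)
Lemma cyclic_mulG_coprime_index (gT : finGroupType) (G H K : {group gT}) :
  cyclic G -> H \subset G -> K \subset G ->
  ((H * K)%g == G :> {set gT}) = coprime #|G : H|%g #|G : K|%g.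
Proof.
move=> cycG sHG sKG; apply/eqP/idP => [defG|]; last exact: coprime_index_mulG.
apply: contraT => gcd_neq1; set g := gcdn #|G : H|%g #|G : K|%g.
have g_gt1 : 1 < g by rewrite ltn_neqAle eq_sym gcd_neq1 gcdn_gt0 indexg_gt0.
have pr_p := pdiv_prime g_gt1; have p_g := pdiv_dvd g.
have p_H := dvdn_trans p_g (dvdn_gcdl _ _).
have p_K := dvdn_trans p_g (dvdn_gcdr _ _).
have [L sLG iL] := cyclic_exists_index cycG (dvdn_trans p_H (dvdn_indexg _ _)).
have : G \subset L.
  by rewrite -{1}defG mul_subG // (cyclic_sub_index cycG) // iL.
by rewrite -indexg_eq1 iL gtn_eqF // prime_gt1.
Qed.

Section CyclicComax.

Variables (gT : finGroupType) (G : {group gT}).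
Hypothesis cycG : cyclic G.
Local Notation n := #|G|.

Definition comax_index (u : comax_graph G) : nat := #|G : val u|%g.

Lemma comax_index_gt1 u : 1 < comax_index u.
Proof. by rewrite indexg_gt1; case/andP: (valP u) => _ /andP[]. Qed.

Lemma comax_index_dvd u : comax_index u %| n.
Proof. exact: dvdn_indexg. Qed.

Lemma comax_index_inj : injective comax_index.
Proof.
rewrite /comax_index => u v eq_uv; apply/val_inj/val_inj/eqP.
have sub := cyclic_sub_index cycG (comax_vertex_sub _) (comax_vertex_sub _).
by rewrite eqEsubset (sub u v) (sub v u) eq_uv dvdnn.
Qed.

Lemma comax_edgeE u v : edge u v = coprime (comax_index u) (comax_index v).
Proof.
rewrite -cyclic_mulG_coprime_index ?comax_vertex_sub //=.
rewrite /comax_edge; case: eqP => //= ->.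
by rewrite mulGid; apply/esym/negbTE; case/andP: (valP v) => _ /proper_neq.
Qed.

(** The bounds on [d] exclude the trivial subgroup and [G], which are not
    vertices. *)
Lemma comax_vertex_index d : d %| n -> 1 < d < n -> exists u, comax_index u = d.
Proof.
move=> d_n /andP[d_gt1 d_lt]; have [H sHG iH] := cyclic_exists_index cycG d_n.
suff vH : (H :!=: 1%g) && (H \proper G) by exists (Sub H vH).
rewrite properEneq sHG andbT; apply/andP; split.
  by apply: contraTneq d_lt => H1; rewrite -iH H1 indexg1 ltnn.
by apply: contraTneq d_gt1 => HG; rewrite -iH HG indexgg.
Qed.

(** Neither index can be [n], which is coprime to no divisor of [n] greater
    than 1. *)
Lemma comax_edge_index d e : d %| n -> e %| n -> 1 < d -> 1 < e -> coprime d e ->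
  exists u v, [/\ edge u v, comax_index u = d & comax_index v = e].
Proof.
have lt a b : a %| n -> b %| n -> 1 < b -> coprime a b -> a < n.
  move=> a_n b_n b_gt1 co_ab; rewrite ltn_neqAle dvdn_leq // andbT.
  apply: contraTneq co_ab => ->.
  by rewrite /coprime; move/gcdn_idPr: b_n => ->; rewrite gtn_eqF.
move=> d_n e_n d_gt1 e_gt1 co_de.
have [|u iu] := comax_vertex_index d_n; first by rewrite d_gt1 (lt d e).
have [|v iv] := comax_vertex_index e_n.
  by rewrite e_gt1 (lt e d) // coprime_sym.
by exists u, v; rewrite comax_edgeE iu iv.
Qed.

(** A centre constrains the divisors of [n], since each pair of them as below
    is the pair of indices of an edge. *)
Lemma centre_coprime c d e : is_centre c -> d %| n -> e %| n -> 1 < d -> 1 < e ->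
  coprime d e -> comax_index c = d \/ comax_index c = e.
Proof.
move=> [_ centre_c] d_n e_n d_gt1 e_gt1 co_de.
have [u [v [uv <- <-]]] := comax_edge_index d_n e_n d_gt1 e_gt1 co_de.
by case: (centre_c _ _ uv) => ->; [left | right].
Qed.

Lemma cyclic_comax_centreP :
  (exists c : comax_graph G, is_centre c) <->
  exists p q r : nat, [/\ prime p, prime q, p != q, 0 < r & n = p ^ r * q].
Proof.
split=> [[c centre_c]|[p [q [r [pr_p pr_q neq_pq r_gt0 oG]]]]].
  have [[y cy] _] := centre_c; set k := comax_index c.
  have pr_l := pdiv_prime (comax_index_gt1 c).
  have pr_p := pdiv_prime (comax_index_gt1 y).
  move: (pdiv_dvd k) (pdiv_dvd (comax_index y)) pr_l pr_p.
  set l := pdiv k; set p := pdiv _ => l_k p_y pr_l pr_p.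
  have co_kp : coprime k p.
    by move: cy; rewrite comax_edgeE; apply: coprime_dvdr.
  have neq_kp : k <> p by move=> eq_kp; move: co_kp; rewrite eq_kp prime_coprime // dvdnn.
  have k_n : k %| n := comax_index_dvd c.
  have p_n : p %| n := dvdn_trans p_y (comax_index_dvd y).
  (* Replacing k by its prime divisor l in a coprime pair shows that k is l. *)
  have eq_kl : k = l.
    have [//|//] := centre_coprime centre_c (dvdn_trans l_k k_n) p_n
      (prime_gt1 pr_l) (prime_gt1 pr_p) (coprime_dvdl l_k co_kp).
  (* The pair formed by p and the p'-part m of n has to contain k, so m = k. *)
  have [m co_pm def_n] := pfactor_coprime pr_p (cardG_gt0 G).
  have k_m : k %| m.
    by rewrite -(Gauss_dvdl m (coprimeXr (logn p n) co_kp)) -def_n.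
  have m_n : m %| n by rewrite def_n dvdn_mulr.
  have m_gt1 : 1 < m.
    apply: leq_trans (comax_index_gt1 c) (dvdn_leq _ k_m).
    exact: dvdn_gt0 (cardG_gt0 G) m_n.
  have [//|eq_km] := centre_coprime centre_c p_n m_n (prime_gt1 pr_p) m_gt1 co_pm.
  exists p, k, (logn p n); split=> //.
  - by rewrite eq_kl.
  - by rewrite eq_sym; apply/eqP.
  - by rewrite logn_gt0 mem_primes pr_p cardG_gt0.
  - by rewrite /k eq_km mulnC.
have q_n : q %| n by rewrite oG dvdn_mull.
have p_n : p %| n by rewrite oG dvdn_mulr // dvdn_exp.
have co_qp : coprime q p by rewrite prime_coprime // dvdn_prime2 // eq_sym.
have [c [v [cv ic _]]] :=
  comax_edge_index q_n p_n (prime_gt1 pr_q) (prime_gt1 pr_p) co_qp.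
(* An index prime to p divides q, so that it determines the vertex. *)
have eq_c w : ~~ (p %| comax_index w) -> w = c.
  rewrite -prime_coprime // coprime_sym => co_wp; apply: comax_index_inj.
  move: (comax_index_gt1 w) (comax_index_dvd w).
  rewrite oG Gauss_dvdr ?coprimeXr // ic => w_gt1.
  by case/primeP: pr_q => _ /[apply] /orP[]/eqP eq_w //; rewrite eq_w in w_gt1.
exists c; split=> [|x y]; first by exists v.
rewrite comax_edgeE => co_xy.
have [p_x|/eq_c] := boolP (p %| comax_index x); last by left.
right; apply: eq_c; rewrite -prime_coprime //.
exact: coprime_dvdl p_x co_xy.
Qed.

End CyclicComax.

(** All Sylow subgroups have order dividing a prime, hence are cyclic, and a
    nilpotent group with cyclic Sylow subgroups is cyclic. *)
Lemma nilpotent_card_prime2_cyclic (gT : finGroupType) (G : {group gT}) (p q : nat) :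
  nilpotent G -> prime p -> prime q -> p != q -> #|G| = p * q -> cyclic G.
Proof.
move=> nilG pr_p pr_q neq_pq oG; apply: nil_Zgroup_cyclic nilG.
apply/forall_inP=> S /SylowP[l pr_l sylS].
apply: (@dvdn_prime_cyclic _ _ l) => //.
rewrite (card_Hall sylS) p_part -[X in _ %| X]expn1 dvdn_Pexp2l ?prime_gt1 //.
rewrite oG lognM ?prime_gt0 // !logn_prime //.
by have [->|_] := eqVneq l p; rewrite ?(negbTE neq_pq) ?leq_b1.
Qed.

Theorem theorem3p4 (gT : finGroupType) (G : {group gT}) (nilG : nilpotent G) :
  is_star (deleted_comax_graph G) <->
  exists p q : nat,
    [/\ prime p, prime q, p != q &
       #|G| = p * q \/
       (cyclic G /\ exists2 r : nat, 2 <= r & #|G| = p ^ r * q)].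
Proof.
split=> [/star_centre[c centre_c] | [p [q [pr_p pr_q neq_pq oG]]]].
  have cycG := comax_centre_cyclic nilG centre_c.
  have [p [q [[|[|r]] [pr_p pr_q neq_pq // _ oG]]]] :=
    (cyclic_comax_centreP cycG).1 (ex_intro _ c centre_c).
    by exists p, q; split=> //; left; rewrite oG expn1.
  by exists p, q; split=> //; right; split=> //; exists r.+2.
apply: centre_star.
case: oG => [oG | [cycG [r r_gt1 oG]]].
  apply/cyclic_comax_centreP; first exact: nilpotent_card_prime2_cyclic oG.
  by exists p, q, 1; rewrite expn1.
by apply/(cyclic_comax_centreP cycG); exists p, q, r; split; rewrite // ltnW.
Qed.
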